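(* For $i=1,\ldots,l$ let $G_i$ be a directed graph with $n_i$ nodes (node sets pairwise disjoint), $\mathcal{C}^i=\{C^i_1,\ldots,C^i_{m_i}\}$ a set of node-disjoint chains covering $V(G_i)$ with set of sources $V^i_C$, and $T^i$ a time function for $\mathcal{C}^i$ with $G_i\in\mathcal{G}^{\mathcal{C}^i,T^i}$. Let $n=\sum_in_i$, $m=\sum_im_i$, let $E^*$ be a set of inter-graph edges and $G=\mathrm{comb}(\bigcup_iG_i,E^* )$. Let $\mathcal{C}=\bigcup_i\mathcal{C}^i$ and let $T$ be the time function produced by Procedure 1 from some admissible sequence $S$, with $T_{\max}$ computed with respect to $\mathcal{C}$ and $T$. If for all $u\in V(G_i)$ and $v\in V(G_j)$ with $i\neq j$ and $T_{\max}(u)<T(v)$ we have $(u,v)\notin E^*$, then every LTI network whose graph belongs to $\mathcal{G}_u$, with control node set $\bigcup_iV^i_C$, is strongly structurally controllable. Moreover, the largest set of edges that can be added between the graphs $G_1,\ldots,G_l$ while preserving strong structural controllability of every network with graph in $\mathcal{G}_u$ is $E^*_{\max}=\{(u,v): u\in V(G_i),\ v\in V(G_j),\ 1\le i,j\le l,\ i\neq j,\ T_{\max}(u)\geq T(v)\}$, and $|E^*_{\max}|=\frac12n(n+1)+\frac12m(2n-m-1)-\sum_{i=1}^l\left(\frac12n_i(n_i+1)+\frac12m_i(2n_i-m_i-1)\right)$.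
   Context: Graphs are directed, self-loops allowed. $\mathcal{Q}(G)=\{A:\text{for } i\neq j,\ A_{ij}\neq0\iff(j,i)\in E(G)\}$; for control nodes $V_C=\{j_1,\ldots,j_k\}$, $B=[e_{j_1},\ldots,e_{j_k}]$; the LTI network on $G$ with control nodes $V_C$ is strongly structurally controllable if $(A,B)$ is controllable for all $A\in\mathcal{Q}(G)$. A chain is a directed path graph with source (start node) and sink (end node); for a non-sink $v$, $v+1$ is its out-neighbor. For node-disjoint chains $\mathcal{C}$ with $m$ chains, $V=\bigcup V(C)$, $\gamma=|V|-m+1$, a time function is $T:V\to\{1,\ldots,\gamma\}$ with (1) $T(v)=1$ for every source; (2) distinct non-source nodes get distinct values; (3) $T(v)<T(v+1)$ for non-sink $v$. $T_{\max}(v)=\gamma$ for a sink, else $T(v+1)-1$. $\mathcal{G}^{\mathcal{C},T}$ is the set of graphs $G$ with $V(G)=V$, containing all chain edges, and with $(u,v)\notin E(G)$ whenever $(u,v)$ is not a chain edge and $T_{\max}(u)<T(v)$. Combination: an inter-graph edge is $(u,v)$ with $u\in V(G_i)$, $v\in V(G_j)$, $i\neq j$. For a set $E^*$ of inter-graph edges, $\mathrm{comb}(\bigcup_iG'_i,E^* )$ is the graph with node set $\bigcup_iV(G'_i)$ and edge set $\bigcup_iE(G'_i)\cup E^*$. $\mathcal{G}_u$ is the class of all graphs $\mathrm{comb}(\bigcup_iG'_i,E^* )$ with $G'_i\in\mathcal{G}^{\mathcal{C}^i,T^i}$ for each $i$. Procedure 1: let $q_i=n_i-m_i$ and let $S$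 be any sequence of length $n-m$ of elements of $\{G_1,\ldots,G_l\}$ in which each $G_i$ occurs exactly $q_i$ times. Define $T:\bigcup_iV(G_i)\to\{1,\ldots,n-m+1\}$ by: $T(v)=1$ if $v$ is a source of $\mathcal{C}^i$; and if $v\in V(G_i)$ with $T^i(v)=j+1$, $j\geq1$, then $T(v)=k+1$ where $k$ is the position in $S$ of the $j$th occurrence of $G_i$. *)

(* Defs.v *)
(* Nodes of the combined network are 'I_n; node i of the
   combined graph belongs to G_(part i). Edge sets are finite sets of pairs. *)
From HB Require Import structures.
From mathcomp Require Import all_boot all_order all_algebra.
From mathcomp Require Import reals.
Set Implicit Arguments. Unset Strict Implicit. Unset Printing Implicit Defensive.
Import Order.TTheory GRing.Theory Num.Theory.

Section Chains.
Variable n : nat.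
Local Notation V := 'I_n.

(* A chain is a nonempty sequence of nodes [v_1; ...; v_p] (the path
   v_1 -> v_2 -> ... -> v_p); a family of chains is a seq of chains. *)
Definition chain_edge (cs : seq (seq V)) (u v : V) : bool :=
  has (fun c => (u, v) \in zip c (behead c)) cs.

Definition is_source (cs : seq (seq V)) (v : V) : bool :=
  has (fun c => (c != [::]) && (head v c == v)) cs.

Definition is_sink (cs : seq (seq V)) (v : V) : bool :=
  has (fun c => (c != [::]) && (last v c == v)) cs.

Definition chain_cover (W : {set V}) (cs : seq (seq V)) : Prop :=
  [/\ all (fun c => c != [::]) cs, uniq (flatten cs)
    & forall v, (v \in W) = (v \in flatten cs)].

Definition gamma (cs : seq (seq V)) : nat := size (flatten cs) - size cs + 1.

Definition time_fn (cs : seq (seq V)) (T : V -> nat) : Prop :=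
  [/\ forall v, v \in flatten cs -> 1 <= T v <= gamma cs,
      forall v, is_source cs v -> T v = 1,
      forall u v, u \in flatten cs -> v \in flatten cs ->
        ~~ is_source cs u -> ~~ is_source cs v -> u != v -> T u != T v
    & forall u v, chain_edge cs u v -> T u < T v].

Definition Tmax (cs : seq (seq V)) (T : V -> nat) (v : V) : nat :=
  if is_sink cs v then gamma cs
  else if [pick w | chain_edge cs v w] is Some w then T w - 1 else gamma cs.

Definition in_GCT (cs : seq (seq V)) (T : V -> nat) (E : {set V * V}) : Prop :=
  [/\ forall u v, (u, v) \in E -> (u \in flatten cs) && (v \in flatten cs),
      forall u v, chain_edge cs u v -> (u, v) \in E
    & forall u v, (u, v) \in E -> ~~ chain_edge cs u v -> ~~ (Tmax cs T u < T v)].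

End Chains.

Section Combination.
Variables (n l : nat).
Local Notation V := 'I_n.

Definition comb (Ep : 'I_l -> {set V * V}) (Es : {set V * V}) : {set V * V} :=
  (\bigcup_(i < l) Ep i) :|: Es.

Definition inter_edges (part : V -> 'I_l) (Es : {set V * V}) : Prop :=
  forall u v, (u, v) \in Es -> part u != part v.

Definition all_chains (cs : 'I_l -> seq (seq V)) : seq (seq V) :=
  flatten [seq cs i | i <- enum 'I_l].

Definition n_ (part : V -> 'I_l) (i : 'I_l) : nat := #|[set v | part v == i]|.
Definition m_ (cs : 'I_l -> seq (seq V)) (i : 'I_l) : nat := size (cs i).

Definition admissible (part : V -> 'I_l) (cs : 'I_l -> seq (seq V)) (S : seq 'I_l) :=
  size S = n - \sum_(i < l) m_ cs i /\
  forall i, count_mem i S = n_ part i - m_ cs i.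

(* 0-based position in S of the j-th (1-based) occurrence of i *)
Definition occ_pos (S : seq 'I_l) (i : 'I_l) (j : nat) : nat :=
  find (fun p => (nth i S p == i) && (count_mem i (take p.+1 S) == j))
       (iota 0 (size S)).

(* Procedure 1: T(v) = 1 for sources; if T^i(v) = j+1 (j >= 1) then
   T(v) = k+1 with k the 1-based position of the j-th occurrence of G_i in S *)
Definition proc1 (part : V -> 'I_l) (cs : 'I_l -> seq (seq V))
    (Ti : 'I_l -> V -> nat) (S : seq 'I_l) (v : V) : nat :=
  if is_source (cs (part v)) v then 1
  else (occ_pos S (part v) (Ti (part v) v - 1)).+2.

End Combination.

Section LTI.
Local Open Scope ring_scope.
Variables (R : realType) (n : nat).

Definition inQ (E : {set 'I_n * 'I_n}) (A : 'M[R]_n) : Prop :=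
  forall i j : 'I_n, i != j -> (A i j != 0) = ((j, i) \in E).

Definition ctrlB (VC : {set 'I_n}) : 'M[R]_(n, #|VC|) :=
  \matrix_(r < n, c < #|VC|) (r == enum_val c)%:R.

Definition controllable (k : nat) (A : 'M[R]_n) (B : 'M[R]_(n, k)) : Prop :=
  \rank (\mxrow_(i < n) (A ^+ i *m B)) = n.

Definition SSC (E : {set 'I_n * 'I_n}) (VC : {set 'I_n}) : Prop :=
  forall A : 'M[R]_n, inQ E A -> controllable A (ctrlB VC).

End LTI.

(* edge bound  1/2 a(a+1) + 1/2 b(2a-b-1)  (both halves are exact) *)
Definition edge_bound (a b : nat) : nat :=
  (a * (a + 1)) %/ 2 + (b * (2 * a - b - 1)) %/ 2.

(* Main.v *)
Require Import Defs.
From HB Require Import structures.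
From mathcomp Require Import all_boot all_order all_algebra.
From mathcomp Require Import reals.
From mathcomp Require Import zify.

Set Implicit Arguments.
Unset Strict Implicit.
Unset Printing Implicit Defensive.
Import GRing.Theory Num.Theory.

(* Sufficiency: along the time order, the chain predecessor u of a node v has all
   its other out-neighbours earlier than v, so a row vector y with
   y A^k B = 0 for k < t vanishes successively on all nodes v with T v <= t.
   Maximality: strong structural controllability makes the control nodes a
   zero forcing set, and n - m forces exhibit C(n - m, 2) missing edges. The
   maximal graph of the combined chains and time function misses exactly that
   many, and since T is increasing in T^i on each part, it restricts on each
   part to the maximal graph of (C^i, T^i); Emax is what remains. *)

(** * Positions, neighbours and endpoints in a family of disjoint chains *)

Lemma mem_zip_behead (A : eqType) (c : seq A) (u v : A) : uniq c ->
  ((u, v) \in zip c (behead c))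
    = [&& u \in c, v \in c & index v c == (index u c).+1].
Proof.
elim: c => // x [|y s] IH uc.
  rewrite [LHS]in_nil !inE; apply/esym/and3P => -[/eqP -> /eqP ->].
  by rewrite eqn_leq ltnn andbF.
have /andP [xs us] := uc.
rewrite -[LHS]/(((u, v) == (x, y))
  || ((u, v) \in zip (y :: s) (behead (y :: s)))).
rewrite IH // xpair_eqE (in_cons x _ u) (in_cons x _ v).
rewrite ![index _ (x :: _)]/= (eq_sym x u) (eq_sym x v).
have [->|nux] /= := eqVneq u x.
  rewrite (negbTE xs) /= orbF.
  have [->|nvx] /= := eqVneq v x.
    by apply: contraNF xs => /eqP ->; rewrite mem_head.
  by rewrite eqSS inE eq_sym; case: eqVneq => //=; rewrite andbF.
have [->|nvx] //= := eqVneq v x.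
by rewrite (negbTE xs) /= andbF.
Qed.

Lemma uniq_flatten_mem (A : eqType) (ss : seq (seq A)) (c c' : seq A) (x : A) :
  uniq (flatten ss) -> c \in ss -> c' \in ss -> x \in c -> x \in c' -> c = c'.
Proof.
elim: ss => //= s ss IH; rewrite cat_uniq => /and3P [_ /hasPn dis us].
have dis' d : d \in ss -> x \in d -> x \notin s.
  by move=> dss xd; apply: dis; apply/flattenP; exists d.
rewrite !inE => /predU1P [->|cs] /predU1P [->|c's] // xc xc'.
- by case/negP: (dis' _ c's xc').
- by case/negP: (dis' _ cs xc).
- exact: IH.
Qed.

Lemma uniq_flatten_in (A : eqType) (ss : seq (seq A)) (c : seq A) :
  uniq (flatten ss) -> c \in ss -> uniq c.
Proof.
elim: ss => //= s ss IH; rewrite cat_uniq => /and3P [us _ uss].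
by rewrite inE => /predU1P [->|/IH]; last exact.
Qed.

Section Chains.
Context {n : nat} {W : {set 'I_n}} {cs : seq (seq 'I_n)}.
Hypothesis cover : chain_cover W cs.
Implicit Types u v w : 'I_n.

Lemma chain_of v : v \in W -> exists2 c, c \in cs & v \in c.
Proof. by case: cover => _ _ ->; move/flattenP. Qed.

Lemma chain_sub c v : c \in cs -> v \in c -> v \in W.
Proof. by case: cover => _ _ -> cc vc; apply/flattenP; exists c. Qed.

(** Disjointness leaves only one chain through [u], so an edge is a step between consecutive
    positions there. Facts about successors, predecessors, sources and sinks thereby reduce to
    arithmetic on [index]. *)
Lemma chain_edgeE c u v : c \in cs -> u \in c ->
  chain_edge cs u v = (v \in c) && (index v c == (index u c).+1).
Proof.
case: cover => _ us _ cc uc; have ucc := uniq_flatten_in us cc.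
apply/hasP/idP => [[d dc]|h]; last first.
  by exists c; rewrite // mem_zip_behead // uc.
rewrite mem_zip_behead ?(uniq_flatten_in us dc) // => /and3P [ud vd].
by rewrite (uniq_flatten_mem us cc dc uc ud) vd.
Qed.

Lemma chain_edge_in u v : chain_edge cs u v ->
  exists2 c, c \in cs & (u \in c) && (v \in c).
Proof.
case: cover => _ us _ /hasP [c cc].
rewrite mem_zip_behead ?(uniq_flatten_in us cc) // => /and3P [uc vc _].
by exists c; rewrite ?uc.
Qed.

Lemma chain_edge_mem u v : chain_edge cs u v -> (u \in W) && (v \in W).
Proof. by case/chain_edge_in => c cc /andP [uc vc]; rewrite !(chain_sub cc). Qed.

Lemma is_sourceE c v : c \in cs -> v \in c -> is_source cs v = (index v c == 0).
Proof.
case: cover => ne us _ cc vc.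
apply/hasP/idP => [[[//|x d] dc /= /eqP xv]|].
  rewrite (uniq_flatten_mem us cc dc vc); last by rewrite xv mem_head.
  by rewrite xv /= eqxx.
move=> i0; exists c => //; case: c vc i0 {cc} => //= x c _.
by case: (x == v).
Qed.

Lemma is_sinkE c v : c \in cs -> v \in c ->
  is_sink cs v = ((index v c).+1 == size c).
Proof.
case: cover => ne us _ cc vc; have ucc := uniq_flatten_in us cc.
apply/hasP/idP => [[[//|x d] dc /= /eqP xv]|].
  rewrite (uniq_flatten_mem us cc dc vc); last by rewrite -xv mem_last.
  by rewrite -{1}xv index_last ?(uniq_flatten_in us dc).
move=> i0; exists c => //.
have -> /= : c != [::] by case: c vc {cc ucc i0}.
by rewrite -nth_last -(eqP i0) nth_index.
Qed.

Lemma chain_edge_target u v : chain_edge cs u v -> ~~ is_source cs v.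
Proof.
move=> e; have [c cc /andP [uc vc]] := chain_edge_in e.
move: e; rewrite (chain_edgeE _ cc uc) (is_sourceE cc vc) => /andP [_ /eqP ->].
by [].
Qed.

Lemma chain_edge_origin u v : chain_edge cs u v -> ~~ is_sink cs u.
Proof.
move=> e; have [c cc /andP [uc vc]] := chain_edge_in e.
move: e; rewrite (chain_edgeE _ cc uc) (is_sinkE cc uc) vc /= => /eqP <-.
by rewrite neq_ltn index_mem vc.
Qed.

Lemma chain_edge_succ_inj u v w :
  chain_edge cs u v -> chain_edge cs u w -> v = w.
Proof.
move=> e; have [c cc /andP [uc vc]] := chain_edge_in e.
move: e; rewrite !(chain_edgeE _ cc uc) => /andP [_ /eqP iv] /andP [wc /eqP iw].
by apply: (index_inj v vc wc); rewrite iv iw.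
Qed.

Lemma chain_edge_pred_inj u v w :
  chain_edge cs u w -> chain_edge cs v w -> u = v.
Proof.
move=> e e'; have [c cc /andP [uc wc]] := chain_edge_in e.
have [d dd /andP [vd wd]] := chain_edge_in e'.
case: cover => _ us _; have eq_cd := uniq_flatten_mem us cc dd wc wd.
subst d; move: e e'; rewrite (chain_edgeE _ cc uc) (chain_edgeE _ cc vd).
move=> /andP [_ /eqP ->] /andP [_ /eqP [iuv]].
exact: (index_inj u uc vd iuv).
Qed.

Lemma chain_pred_ex v : v \in W -> ~~ is_source cs v ->
  exists u, chain_edge cs u v.
Proof.
move=> /chain_of [c cc vc]; rewrite (is_sourceE cc vc) => iv.
have lt : (index v c).-1 < size c.
  by apply: leq_ltn_trans (leq_pred _) _; rewrite index_mem.
have uc := mem_nth v lt; exists (nth v c (index v c).-1).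
rewrite (chain_edgeE _ cc uc) vc /= index_uniq ?prednK ?lt0n //.
  exact: index_size.
by case: cover => _ us _; apply: uniq_flatten_in us cc.
Qed.

Lemma chain_succ_ex u : u \in W -> ~~ is_sink cs u ->
  exists v, chain_edge cs u v.
Proof.
move=> /chain_of [c cc uc]; rewrite (is_sinkE cc uc) => iu.
have lt : (index u c).+1 < size c by rewrite ltn_neqAle iu index_mem.
exists (nth u c (index u c).+1).
rewrite (chain_edgeE _ cc uc) mem_nth //= index_uniq //.
by case: cover => _ us _; apply: uniq_flatten_in us cc.
Qed.

Lemma Tmax_succ T u v : chain_edge cs u v -> Tmax cs T u = T v - 1.
Proof.
move=> e; rewrite /Tmax (negbTE (chain_edge_origin e)).
case: pickP => [w /(chain_edge_succ_inj e) -> //|/(_ v)].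
by rewrite e.
Qed.

Lemma size_flatten_cover : size (flatten cs) = #|W|.
Proof.
case: cover => _ us eW; rewrite -(card_uniqP us); apply: eq_card => v.
by rewrite eW.
Qed.

Lemma source_sub v : is_source cs v -> v \in W.
Proof.
move=> /hasP [c cc /andP [ne /eqP hv]]; apply: (chain_sub cc).
by case: c ne hv {cc} => //= x c _ ->; rewrite mem_head.
Qed.

Lemma card_sources : #|[set v | is_source cs v]| = size cs.
Proof.
case: cover => ne us _.
(* The heads of the chains, in order, form a subsequence of [flatten cs], hence are distinct; each
   chain, being nonempty, contributes exactly one. *)
pose h := flatten [seq take 1 c | c <- cs].
have sub : subseq h (flatten cs).
  rewrite /h; elim: (cs) => //= c s IH.
  by apply: cat_subseq => //; apply: take_subseq.
have -> : size cs = size h.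
  rewrite /h; elim: (cs) ne => //= -[|x c] s IH //= /IH ->.
  by rewrite take0.
rewrite -(card_uniqP (subseq_uniq sub us)); apply: eq_card => v.
rewrite inE; apply/hasP/flattenP => [[[//|x c] cc /= /eqP xv]|[d /mapP[c cc ->]]].
  by exists (take 1 (x :: c)); [apply: map_f|rewrite /= take0 inE xv].
move=> vd; exists c => //; case: c vd {cc} => //= x c.
by rewrite take0 inE eq_sym.
Qed.

End Chains.

(** * Size of the maximal graph of a time function *)

Lemma card_lt_pairs (A : finType) (f : A -> nat) (N : {set A}) :
  {in N &, injective f} ->
  #|[set p : A * A | [&& p.1 \in N, p.2 \in N & f p.1 < f p.2]]| = 'C(#|N|, 2).
Proof.
move=> inj; set P := [set p | _].
pose P' := [set p : A * A | [&& p.1 \in N, p.2 \in N & f p.2 < f p.1]].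
pose D := [set (x, x) | x in N].
have cD : #|D| = #|N| by apply: card_imset => x y [].
have cP' : #|P'| = #|P|.
  have swapK : cancel (fun p : A * A => (p.2, p.1)) (fun p => (p.2, p.1)).
    by case.
  rewrite -(card_imset P (can_inj swapK)); apply: eq_card => -[x y].
  rewrite inE /=; apply/idP/imsetP => [/and3P [xN yN lt]|].
    by exists (y, x); rewrite // inE /= xN yN.
  by case=> -[z t]; rewrite inE /= => /and3P [? ? ?] [-> ->]; apply/and3P.
(* By injectivity of [f] on [N], ties occur only on the diagonal [D]; swapping coordinates makes the
   other two pieces equinumerous. *)
have eqX : setX N N = P :|: P' :|: D.
  apply/setP => -[x y]; rewrite !inE /=; apply/idP/idP.
    move=> /andP [xN yN]; rewrite xN yN /=.
    case: (ltngtP (f x) (f y)) => //= /inj -> //.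
    by apply/imsetP; exists y.
  case/orP => [/orP [] /and3P [-> -> _] //|/imsetP [z zN [-> ->]]].
  by rewrite zN.
have d1 : P :&: P' = set0.
  apply/setP => -[x y]; rewrite !inE /=.
  by case: (ltngtP (f x) (f y)); rewrite ?andbF.
have d2 : (P :|: P') :&: D = set0.
  apply/setP => p; rewrite in_setI in_set0; apply/negP => /andP [h].
  by case/imsetP => x _ e; move: h; rewrite e !inE /= ltnn !andbF.
have := cardsX N N; rewrite eqX cardsU d2 cards0 cardsU d1 cards0 cD cP' bin2.
by case: #|N| => [|k] /=; nia.
Qed.

(** Every edge set satisfying [in_GCT cs T] is contained in this one. *)
Definition Gmax n (cs : seq (seq 'I_n)) (T : 'I_n -> nat) : {set 'I_n * 'I_n} :=
  [set e | [&& e.1 \in flatten cs, e.2 \in flatten cs &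
    chain_edge cs e.1 e.2 || (T e.2 <= Tmax cs T e.1)]].

Section TimeFunction.
Context {n : nat} {W : {set 'I_n}} {cs : seq (seq 'I_n)} {T : 'I_n -> nat}.
Hypotheses (cover : chain_cover W cs) (time : time_fn cs T).
Implicit Types u v w : 'I_n.

Lemma mem_cover v : (v \in flatten cs) = (v \in W).
Proof. by case: cover => _ _ ->. Qed.

Lemma time_gt0 v : v \in W -> 0 < T v.
Proof. by case: time => h _ _ _; rewrite -mem_cover => /h /andP []. Qed.

Lemma time_le_gamma v : v \in W -> T v <= gamma cs.
Proof. by case: time => h _ _ _; rewrite -mem_cover => /h /andP []. Qed.

Lemma time_gt1 v : v \in W -> (1 < T v) = ~~ is_source cs v.
Proof.
case: time => _ s1 _ lt vW; case: (boolP (is_source cs v)) => [/s1 -> //|ns].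
have [u uv] := chain_pred_ex cover vW ns.
have /andP [uW _] := chain_edge_mem cover uv.
exact: leq_ltn_trans (time_gt0 uW) (lt _ _ uv).
Qed.

(** A non-sink has exactly one successor, and at a sink the bound [gamma cs] holds for every time.
    This form removes the case distinction in [Tmax] and compares only values of [T]. *)
Lemma Tmax_time u v : u \in W -> v \in W ->
  (T v <= Tmax cs T u)
    = [forall w, chain_edge cs u w ==> (T v < T w)].
Proof.
move=> uW vW; apply/idP/forallP => [le w|h].
  apply/implyP => uw; move: le; rewrite (Tmax_succ cover T uw).
  have := time_gt0 vW; lia.
case: (boolP (is_sink cs u)) => [su|nsu].
  by rewrite /Tmax su time_le_gamma.
have [w uw] := chain_succ_ex cover uW nsu.
rewrite (Tmax_succ cover T uw); have := implyP (h w) uw; lia.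
Qed.

Lemma Gmax_in_GCT : in_GCT cs T (Gmax cs T).
Proof.
split => [u v|u v e|u v].
- by rewrite inE /= => /and3P [-> ->].
- by rewrite inE /= !mem_cover e; case/andP: (chain_edge_mem cover e) => -> ->.
- rewrite inE /= -leqNgt => /and3P [_ _ /orP [->|]] //.
Qed.

Lemma card_nonsources :
  #|[set v in W | ~~ is_source cs v]| = #|W| - size cs.
Proof.
have sub : [set v | is_source cs v] \subset W.
  by apply/subsetP => v; rewrite inE; apply: source_sub cover _.
rewrite -(card_sources cover) -cardsDS //; apply: eq_card => v.
by rewrite !inE andbC.
Qed.

Lemma size_chains_le : size cs <= #|W|.
Proof.
rewrite -(card_sources cover); apply: subset_leq_card.
by apply/subsetP => v; rewrite inE; apply: source_sub cover _.
Qed.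

Lemma time_inj :
  {in [set v in W | ~~ is_source cs v] &, injective T}.
Proof.
case: time => _ _ inj _ u v; rewrite !inE => /andP [uW su] /andP [vW sv] e.
apply/eqP; apply: contraT => ne; have := inj u v.
by rewrite !mem_cover e eqxx => /(_ uW vW su sv ne).
Qed.

(* A pair (u, v) misses from Gmax iff u has a chain successor w with T w < T v,
   so these pairs correspond to pairs (w, v) of non-sources with T w < T v. *)
Lemma card_Gmax : #|Gmax cs T| + 'C(#|W| - size cs, 2) = #|W| ^ 2.
Proof.
have GW : Gmax cs T \subset setX W W.
  apply/subsetP => -[u v]; rewrite !inE !mem_cover /=.
  by case/and3P => -> ->.
rewrite -card_nonsources -(card_lt_pairs time_inj) -mulnn -cardsX.
rewrite -(cardsID (Gmax cs T) (setX W W)) (setIidPr GW); congr addn.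
set N := [set v in W | _]; set P := [set p | _].
(* The chain predecessor; the default [w] is never reached on [N], whose members are not sources. *)
pose pr w := odflt w [pick u | chain_edge cs u w].
have prE u w : chain_edge cs u w -> pr w = u.
  rewrite /pr => e; case: pickP => [x e'|/(_ u)]; last by rewrite e.
  exact: (chain_edge_pred_inj cover e' e).
have prN w : w \in N -> chain_edge cs (pr w) w.
  rewrite inE => /andP [wW sw]; have [u uw] := chain_pred_ex cover wW sw.
  by rewrite (prE _ _ uw).
pose f (p : 'I_n * 'I_n) := (pr p.1, p.2).
have finj : {in P &, injective f}.
  move=> [x y] [z t]; rewrite !inE /f /= => /and3P [xN _ _] /and3P [zN _ _].
  case=> e ->; congr (_, _).
  have := prN z; rewrite inE zN -e => /(_ isT) e'.
  by apply: (chain_edge_succ_inj cover _ e'); apply: prN; rewrite inE.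
rewrite -(card_in_imset finj); apply: eq_card => -[u v].
case: time => _ _ _ lt.
rewrite inE; apply/imsetP/andP => [[[w t]]|].
  rewrite !inE /f /= => /and3P [/andP [wW sw] /andP [vW sv] ltT] [-> ->].
  have e : chain_edge cs (pr w) w by apply: prN; rewrite inE wW.
  have /andP [pW _] := chain_edge_mem cover e.
  rewrite !mem_cover pW vW /= (Tmax_succ cover T e); split => //.
  rewrite negb_or; apply/andP; split; last by have := lt _ _ e; lia.
  apply/negP => e'; move: ltT.
  by rewrite (chain_edge_succ_inj cover e e') ltnn.
rewrite !inE !mem_cover /= => -[h /andP [uW vW]].
move: h; rewrite uW vW /= negb_or Tmax_time // => /andP [nuv].
rewrite negb_forall => /existsP [w]; rewrite negb_imply -leqNgt => /andP [uw le].
exists (w, v); last by rewrite /f /= (prE _ _ uw).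
have /andP [_ wW] := chain_edge_mem cover uw.
have sw := chain_edge_target cover uw.
have sv : ~~ is_source cs v.
  by rewrite -time_gt1 //; apply: leq_trans le; rewrite time_gt1.
(* Equality would give [w = v] by injectivity on non-sources, and [(u, v)] would then be a chain
   edge. *)
have ltT : T w < T v.
  rewrite ltn_neqAle le andbT.
  apply/eqP => /time_inj; rewrite !inE wW vW sw sv => /(_ isT isT) ewv.
  by rewrite -ewv uw in nuv.
by rewrite !inE /= wW vW sw sv ltT.
Qed.

End TimeFunction.

(** Both halves are exact because each product has an even factor. Stated as a sum, the identity
    matches [card_Gmax] and avoids truncated subtraction. *)
Lemma edge_boundE a b : b <= a -> edge_bound a b + 'C(a - b, 2) = a ^ 2.
Proof.
move=> le; rewrite /edge_bound bin2 -divn2 -(subnKC le); move: (a - b) => k.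
rewrite addKn.
have e1 : 2 %| (b + k) * (b + k + 1) by rewrite dvdn2 addn1 oddM /= andbN.
have e2 : 2 %| k * k.-1 by case: k {e1} => // k; rewrite dvdn2 oddM /= andNb.
(* For [b = c.+1] no subtraction truncates and the second factor has the parity of [c]; for [b = 0]
   the product is zero. *)
have subE c : 2 * (c.+1 + k) - c.+1 - 1 = c + k.*2 by lia.
have e3 : 2 %| b * (2 * (b + k) - b - 1).
  by case: b {e1 le} => // b; rewrite subE dvdn2 oddM oddD odd_double addbF andNb.
apply/eqP; rewrite -(eqn_pmul2r (isT : 0 < 2)) -mulnn !(mulnDl _ _ 2) !divnK //.
apply/eqP; case: b {e1 e3 le} => [|b].
  by case: k {e2 subE} => [|k] //=; lia.
by rewrite subE; case: k {e2 subE} => [|k] /=; lia.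
Qed.

(** * Zero forcing and missing edges *)

Lemma binSC2 k : 'C(k.+1, 2) = 'C(k, 2) + k.
Proof. by rewrite binS bin1. Qed.

(* When u forces v, u has no edge to the nodes that are still outside D, and it
   never forces again, so the missing edges of different forces are distinct. *)
Lemma forcing_card_missing (A : finType) (E : {set A * A}) (D0 : {set A}) :
  (forall D : {set A}, D0 \subset D -> D != setT ->
     exists2 u, u \in D & #|[set w | (w \notin D) && ((u, w) \in E)]| = 1) ->
  'C(#|~: D0|, 2) <= #|~: E|.
Proof.
move=> force.
(* Missing edges that point outside [D] from nodes still having an out-neighbour outside [D]. The
   last condition discards a node once it has forced, which keeps the counts of successive forces
   disjoint. *)
pose M (D : {set A}) := [set p : A * A | [&& p \notin E, p.2 \notin D &
  [exists w, (w \notin D) && ((p.1, w) \in E)]]].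
suff main k (D : {set A}) : D0 \subset D -> #|~: D| = k -> 'C(k, 2) <= #|M D|.
  apply: leq_trans (main _ D0 _ erefl) _ => //.
  by apply: subset_leq_card; apply/subsetP => p; rewrite !inE => /andP [].
elim: k D => [//|k IH] D sD cD.
have nD : D != setT.
  by apply: contra_eq_neq cD => ->; rewrite setCT cards0.
have [u uD /eqP /cards1P [v /setP ev]] := force D sD nD.
have /andP [vD uv] : (v \notin D) && ((u, v) \in E).
  by have := ev v; rewrite !inE eqxx.
have uE w : w \notin D -> ((u, w) \in E) = (w == v).
  by move=> wD; have := ev w; rewrite !inE wD.
have sD' : D0 \subset v |: D by apply: subset_trans sD (subsetUr _ _).
have cD' : #|~: (v |: D)| = k.
  apply/eqP; rewrite -eqSS -cD (cardsD1 v (~: D)) !inE vD /= add1n eqSS.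
  by apply/eqP; apply: eq_card => w; rewrite !inE negb_or.
rewrite binSC2; apply: leq_trans (leq_add (IH _ sD' cD') (leqnn k)) _.
(* The [k] missing edges charged to this force: from [u] to every node outside [D] other than
   [v]. *)
pose U := [set (u, w) | w in ~: (v |: D)].
have cU : #|U| = k by rewrite card_imset // => x y [].
have dis : M (v |: D) :&: U = set0.
  apply/setP => p; rewrite in_setI in_set0; apply/negP => /andP [h].
  case/imsetP => w _ e; move: h; rewrite e inE => /and3P [_ _ /existsP [t]].
  rewrite !inE negb_or => /andP [/andP [tv tD]] /=.
  by rewrite uE // (negbTE tv).
rewrite -[X in _ + X]cU -cardsUI dis cards0 addn0; apply: subset_leq_card.
apply/subsetP => -[a b]; rewrite in_setU => /orP [|/imsetP [w]].
  rewrite !inE /= => /and3P [-> + /existsP [w]]; rewrite !negb_or.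
  case/andP => _ ->; rewrite !inE negb_or => /andP [/andP [_ wD] aw].
  by apply/existsP; exists w; rewrite wD.
rewrite !inE negb_or => /andP [wv wD] [-> ->] /=.
by rewrite uE // wv wD; apply/existsP; exists v; rewrite vD.
Qed.

(** * Controllability, time functions and forcing *)

Section Control.
Local Open Scope ring_scope.
Context {R : realType} {n : nat}.
Implicit Types (A : 'M[R]_n) (E : {set 'I_n * 'I_n}) (VC : {set 'I_n}).

Lemma mulmx_ctrlB_eq0 VC (x : 'rV[R]_n) :
  x *m ctrlB R VC = 0 <-> (forall v, v \in VC -> x 0 v = 0).
Proof.
have ev c : (x *m ctrlB R VC) 0 c = x 0 (enum_val c).
  rewrite mxE (bigD1 (enum_val c)) //= mxE eqxx mulr1 big1 ?addr0 // => i ne.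
  by rewrite mxE (negbTE ne) mulr0.
split=> [/rowP x0 v vC|x0].
  by have := x0 (enum_rank_in vC v); rewrite ev enum_rankK_in // mxE.
by apply/rowP => c; rewrite ev mxE x0 // enum_valP.
Qed.

(** Full row rank means a trivial left kernel, so both directions of the main argument can work with
    a single row vector. *)
Lemma controllableP k A (B : 'M[R]_(n, k)) :
  controllable A B <-> (forall x : 'rV_n,
    (forall i, (i < n)%N -> x *m (A ^+ i *m B) = 0) -> x = 0).
Proof.
have eqM (x : 'rV_n) : x *m \mxrow_(i < n) (A ^+ i *m B) = 0 <->
    (forall i, (i < n)%N -> x *m (A ^+ i *m B) = 0).
  rewrite mul_mxrow; split=> [x0 i lt|x0].
    have := congr1 (fun M => submxrow M (Ordinal lt)) x0.
    by rewrite mxrowK /= => ->; apply/matrixP => a b; rewrite !mxE.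
  by apply/matrixP => a b; rewrite mxE x0 // !mxE.
split=> [/eqP rk x /eqM x0|x0].
  by apply/eqP; rewrite -(mulmx_free_eq0 x (rk : row_free _)) x0.
by apply/eqP/inj_row_free => x /eqM; apply: x0.
Qed.

Lemma SSC_of_GCT (cs : seq (seq 'I_n)) (T : 'I_n -> nat) E :
  chain_cover setT cs -> time_fn cs T -> in_GCT cs T E ->
  SSC R E [set v | is_source cs v].
Proof.
move=> cover time [_ chE nchE] A qA.
set VC := [set v | _]; apply/controllableP => x x0.
(* The vector [y] is quantified so that the induction hypothesis also applies to [y *m A], which
   satisfies one condition fewer. *)
have vanish t (y : 'rV_n) :
    (forall i, (i < t)%N -> y *m (A ^+ i *m ctrlB R VC) = 0) ->
    forall v, (T v <= t)%N -> y 0 v = 0.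
  elim: t y => [|t IH] y y0 v.
    by rewrite leqNgt (time_gt0 cover time) ?inE.
  have yv : forall v, (T v <= t)%N -> y 0 v = 0.
    by apply: IH => i lt; apply: y0; apply: ltnW.
  have yAv : forall v, (T v <= t)%N -> (y *m A) 0 v = 0.
    apply: IH => i lt; have := y0 i.+1 lt.
    by rewrite exprS !mulmxA.
  rewrite leq_eqVlt => /orP [/eqP Tv|/yv //].
  have [sv|sv] := boolP (is_source cs v).
    have := y0 0 isT; rewrite expr0 mul1mx => /mulmx_ctrlB_eq0; apply.
    by rewrite inE.
  have [u uv] := chain_pred_ex cover (in_setT v) sv.
  have Tu : (T u <= t)%N by case: time => _ _ _ /(_ _ _ uv); rewrite Tv.
  have nuv : v != u by apply: contraTneq Tu => <-; rewrite Tv ltnn.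
  (* Expand coordinate [u] of [y *m A]. Entries at nodes of time at most [t] vanish, including that
     of [u], which disposes of the free diagonal entry; later nodes other than [v] are not
     out-neighbours of [u]. Only [y 0 v * A v u] remains, and [A v u] is nonzero. *)
  have := yAv u Tu; rewrite mxE (bigD1 v) //= big1 => [/eqP|w nwv].
    rewrite addr0 mulf_eq0 => /orP [/eqP //|].
    by have := qA _ _ nuv; rewrite chE // => /negbTE ->.
  have [Tw|Tw] := leqP (T w) t; first by rewrite yv ?mul0r.
  have nwu : w != u by apply: contraTneq Tu => <-; rewrite -ltnNge.
  apply/eqP; rewrite mulf_eq0; apply/orP; right.
  apply: contraT; rewrite qA // => uw.
  have nch : ~~ chain_edge cs u w.
    by apply: contraNN nwv => /(chain_edge_succ_inj cover uv) ->.
  by have := nchE _ _ uw nch; rewrite (Tmax_succ cover T uv) Tv subn1 Tw.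
apply/rowP => v; rewrite mxE; apply: (vanish n) => //.
(* The node [v] witnesses that there is at least one chain, whence [gamma cs <= n] and the [n]
   available conditions suffice. *)
have vC : v \in flatten cs by case: cover => _ _ <-; rewrite inE.
have cs0 : (0 < size cs)%N by case: (cs) vC.
apply: leq_trans (time_le_gamma cover time (in_setT v)) _.
rewrite /gamma (size_flatten_cover cover) cardsT card_ord.
by have := ltn_ord v; lia.
Qed.

(* Were D stuck, the indicator of its complement would be a left null vector,
   orthogonal to the inputs, of a suitable matrix of the graph: in each column,
   the free diagonal entry or one of at least two nonzero entries outside D is
   chosen so that the entries outside D sum to zero. *)
Lemma SSC_force E VC (D : {set 'I_n}) :
  SSC R E VC -> VC \subset D -> D != setT ->
  exists2 u, u \in D & #|[set w | (w \notin D) && ((u, w) \in E)]| = 1%N.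
Proof.
move=> ssc sD nD.
pose N u := [set w | (w \notin D) && ((u, w) \in E)].
case: (pickP [pred u in D | #|N u| == 1%N]) => [u /andP [uD /eqP]|stuck].
  by exists u.
(* The row in which column [j] is balanced: the diagonal for [j] outside [D], an out-neighbour
   outside [D] for [j] in [D]. The default [j] means that [N j] is empty and there is nothing to
   balance. *)
pose p j := if j \in D then odflt j [pick w in N j] else j.
pose s j : R := \sum_(i | (i \notin D) && (i != p j)) ((j, i) \in E)%:R.
pose A : 'M[R]_n := \matrix_(i, j)
  (if i == p j then - s j else ((j, i) \in E)%:R).
have pP j : p j != j -> [/\ j \in D, p j \in N j & (1 < #|N j|)%N].
  rewrite /p; case: ifP => [jD|_]; last by rewrite eqxx.
  case: pickP => [w wN _|_]; last by rewrite eqxx.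
  split=> //=; rewrite ltn_neqAle eq_sym.
  have := stuck j; rewrite /= jD /= => -> /=.
  by apply/card_gt0P; exists w.
have qA : inQ E A.
  move=> i j nij; rewrite mxE; case: ifP => [/eqP e|_]; last first.
    by case: (_ \in _); rewrite ?oner_eq0 ?eqxx.
  rewrite e in nij *; have [jD pN cN] := pP j nij.
  have -> : (j, p j) \in E by move: pN; rewrite inE => /andP [].
  move: cN; rewrite (cardsD1 (p j)) pN ltnS => /card_gt0P [w].
  rewrite !inE => /and3P [wp wD jw].
  (* A second element [w] of [N j] makes [s j] a positive natural number, nonzero in characteristic
     zero, so the balancing entry respects the edge [(j, p j)]. *)
  by rewrite oppr_eq0 /s -natr_sum pnatr_eq0 (bigD1 w) /= ?wD // jw.
have := ssc A qA => /controllableP ctr.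
pose x : 'rV[R]_n := \row_i (i \notin D)%:R.
have xA : x *m A = 0.
  apply/rowP => j; rewrite !mxE.
  under eq_bigr => i _ do rewrite mxE mulr_natl mulrb.
  rewrite -big_mkcond /=; have [pD|pD] := boolP (p j \in D); last first.
    rewrite (bigD1 (p j)) //= mxE eqxx; apply/eqP; rewrite addr_eq0 eqr_opp.
    apply/eqP; apply: eq_bigr => i /andP [_ ne].
    by rewrite mxE (negbTE ne).
  (* If the balancing row lies in [D], the default was taken, so column [j] has no nonzero entry
     outside [D]. *)
  have jN w : w \notin N j.
    have jD : j \in D.
      by apply: contraT => njD; move: pD; rewrite /p !(negbTE njD).
    move: pD; rewrite /p jD; case: pickP => [y /=|/(_ w) /= ->] //.
    by rewrite inE => /andP [/negbTE ->].
  apply: big1 => i iD; have := jN i; rewrite mxE inE iD /= => /negbTE ->.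
  by case: eqP iD pD => // -> /negbTE ->.
have xB : x *m ctrlB R VC = 0.
  apply/mulmx_ctrlB_eq0 => v /(subsetP sD) vD.
  by rewrite mxE vD.
have x0 : x = 0.
  apply: ctr => -[|i] _; first by rewrite expr0 mul1mx.
  by rewrite exprS mulmxA [x *m _]mulmxA xA !mul0mx.
case/negP: nD; rewrite eqEsubset subsetT /=; apply/subsetP => v _.
apply: contraT => vD; have /rowP /(_ v) := x0.
by rewrite !mxE vD => /eqP; rewrite oner_eq0.
Qed.

(** [SSC_force] lets forcing continue from [VC] until every node is reached, so
    [forcing_card_missing] bounds from below the missing pairs among all [n ^ 2], loops included. *)
Lemma SSC_card E VC : SSC R E VC -> (#|E| + 'C(n - #|VC|, 2) <= n ^ 2)%N.
Proof.
move=> ssc; have <- : #|~: VC| = (n - #|VC|)%N by rewrite cardsCs setCK card_ord.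
apply: leq_trans (_ : #|E| + #|~: E| <= _)%N.
  rewrite leq_add2l; apply: forcing_card_missing => D sD nD.
  exact: SSC_force ssc sD nD.
by rewrite cardsC card_prod card_ord mulnn.
Qed.

End Control.

(** * Positions of occurrences in a sequence *)

Section OccPos.
Context {l : nat}.
Implicit Types (S : seq 'I_l) (i : 'I_l) (j : nat).

Lemma occ_ex S i j : 0 < j <= count_mem i S ->
  exists2 p, p < size S & (nth i S p == i) && (count_mem i (take p.+1 S) == j).
Proof.
elim: S j => [|x S IH] j /=; first by case: j.
have [->|nx] := eqVneq x i.
  case: j => [//|[_|j h]]; first by exists 0; rewrite // take0 /= eqxx.
  have [//|p lt /andP [n1 c1]] := IH j.+1.
  by exists p.+1; rewrite //= n1 add1n eqSS.
move=> h; have [//|p lt /andP [n1 c1]] := IH j.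
by exists p.+1; rewrite //= n1.
Qed.

Lemma occ_posP S i j : 0 < j <= count_mem i S ->
  [/\ occ_pos S i j < size S, nth i S (occ_pos S i j) = i
    & count_mem i (take (occ_pos S i j).+1 S) = j].
Proof.
move=> /occ_ex [p lt pP]; rewrite /occ_pos; set a := (fun p => _).
have hs : has a (iota 0 (size S)).
  by apply/hasP; exists p; rewrite // mem_iota.
have lt' : find a (iota 0 (size S)) < size S.
  by move: hs; rewrite has_find size_iota.
have := nth_find 0 hs; rewrite nth_iota // add0n => /andP [/eqP n1 /eqP c1].
by split.
Qed.

(** Prefix counts are monotone: were the [k]-th occurrence not later, its prefix would lie within
    that of the [j]-th, giving [k <= j]. *)
Lemma occ_pos_ltn S i j k : 0 < j -> j < k -> k <= count_mem i S ->
  occ_pos S i j < occ_pos S i k.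
Proof.
move=> j0 jk kc.
have [|_ _ cj] := @occ_posP S i j; first by lia.
have [|_ _ ck] := @occ_posP S i k; first by lia.
rewrite ltnNge; apply/negP => le; suff : k <= j by lia.
rewrite -cj -ck -(cat_take_drop (occ_pos S i k).+1 (take (_ S i j).+1 S)).
rewrite count_cat.
by rewrite take_takel // leq_addr.
Qed.

(** A position determines both the element of [S] found there and how often it has occurred so
    far. *)
Lemma occ_pos_inj S i i' j j' :
  0 < j <= count_mem i S -> 0 < j' <= count_mem i' S ->
  occ_pos S i j = occ_pos S i' j' -> i = i' /\ j = j'.
Proof.
move=> /occ_posP [lt ni cj] /occ_posP [_ ni' cj'] e.
have ii' : i = i' by rewrite -ni -ni' -e; apply: set_nth_default.
by split=> //; rewrite -cj -cj' -e ii'.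
Qed.

End OccPos.

(** * Procedure 1 and the combined network *)

Section Combined.
Context {n l : nat} {part : 'I_n -> 'I_l} {cs : 'I_l -> seq (seq 'I_n)}.
Hypothesis cover : forall i, chain_cover [set v | part v == i] (cs i).
Implicit Types u v w : 'I_n.
Local Notation C := (all_chains cs).

Lemma all_chainsP c : reflect (exists i, c \in cs i) (c \in C).
Proof.
apply: (iffP flattenP) => [[s /mapP [i _ ->]]|[i ci]]; first by exists i.
by exists (cs i); rewrite // map_f // mem_enum.
Qed.

Lemma chain_part i c v : c \in cs i -> v \in c -> part v = i.
Proof. by move=> ci /(chain_sub (cover i) ci); rewrite inE => /eqP. Qed.

(** A chain containing [v] belongs to the part of [v], so predicates that only hold on chains
    through [v] are local to that part. *)
Lemma has_all_chains (P : pred (seq 'I_n)) v :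
  (forall c, P c -> v \in c) -> has P C = has P (cs (part v)).
Proof.
move=> Pv; apply/hasP/hasP => -[c cC Pc]; exists c => //.
  by have /all_chainsP [i ci] := cC; rewrite (chain_part ci (Pv _ Pc)).
by apply/all_chainsP; exists (part v).
Qed.

Lemma is_source_comb v : is_source C v = is_source (cs (part v)) v.
Proof.
by apply: has_all_chains => -[//|x c] /eqP <-; rewrite mem_head.
Qed.

Lemma chain_edge_comb u v : chain_edge C u v = chain_edge (cs (part u)) u v.
Proof.
apply: has_all_chains => c; elim: c => //= x [//|y c] IH.
by rewrite inE xpair_eqE in_cons => /orP [/andP [->] //|/IH ->]; rewrite orbT.
Qed.

Lemma chain_edge_part u v : chain_edge C u v -> part v = part u.
Proof.
rewrite chain_edge_comb => /(chain_edge_mem (cover _)) /andP [_].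
by rewrite inE => /eqP.
Qed.

Lemma all_chains_cover : chain_cover setT C.
Proof.
split.
- apply/allP => c /all_chainsP [i]; case: (cover i) => /allP ne _ _.
  exact: ne.
- rewrite /all_chains; elim: (enum _) (enum_uniq 'I_l) => //= i r IH.
  case/andP => ir ur; rewrite flatten_cat cat_uniq IH // andbT.
  case: (cover i) => _ -> covi /=; apply/hasPn => v.
  case/flattenP => c /flattenP [s /mapP [k kr ->] ck] vc.
  rewrite -covi inE (chain_part ck vc); apply: contraNneq ir => <-.
  exact: kr.
- move=> v; rewrite in_setT; apply/esym/flattenP.
  have [|c cc vc] := chain_of (cover (part v)) (v := v); first by rewrite inE.
  by exists c => //; apply/all_chainsP; exists (part v).
Qed.

Lemma size_all_chains : size C = \sum_(i < l) m_ cs i.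
Proof.
by rewrite /all_chains size_flatten /shape -map_comp sumnE big_map big_enum.
Qed.

Context {Ti : 'I_l -> 'I_n -> nat} {S : seq 'I_l}.
Hypotheses (time : forall i, time_fn (cs i) (Ti i)) (adm : admissible part cs S).
Local Notation T := (proc1 part cs Ti S).

Lemma mem_part v : v \in [set w | part w == part v].
Proof. by rewrite inE. Qed.

(** A non-source has time between 2 and [gamma (cs i)], and [gamma (cs i) - 1] is the number of
    occurrences of its part [i] in [S]; hence [occ_pos] really finds a position. *)
Lemma occ_range v : ~~ is_source (cs (part v)) v ->
  0 < Ti (part v) v - 1 <= count_mem (part v) S.
Proof.
rewrite -(time_gt1 (cover _) (time _)) ?mem_part // => gt1.
have := time_le_gamma (cover _) (time _) (mem_part v).
rewrite /gamma (size_flatten_cover (cover _)); case: adm => _ ->.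
by rewrite /n_ /m_; move: (_ - size _) => k; lia.
Qed.

Lemma proc1_ltn v w : part v = part w ->
  Ti (part v) v < Ti (part v) w -> T v < T w.
Proof.
rewrite /proc1 => e lt.
have sw : ~~ is_source (cs (part w)) w.
  rewrite -(time_gt1 (cover _) (time _)) ?mem_part // -e.
  by apply: leq_ltn_trans lt; rewrite (time_gt0 (cover _) (time _)) ?mem_part.
rewrite (negbTE sw); have [//|sv] := boolP (is_source _ v).
have := occ_range sv; have := occ_range sw; rewrite -e => hw hv.
by rewrite !ltnS; apply: occ_pos_ltn; lia.
Qed.

Lemma proc1_ltE v w : part v = part w -> ~~ is_source C w ->
  (T v < T w) = (Ti (part v) v < Ti (part v) w).
Proof.
move=> e sw; apply/idP/idP; last exact: proc1_ltn.
rewrite ltnNge; apply: contraNT; rewrite -leqNgt leq_eqVlt.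
case/orP => [/eqP ew|lt]; last by apply/ltnW/proc1_ltn; rewrite -e.
rewrite is_source_comb in sw.
(* With equal times in the part, [v] is a non-source too and both nodes get the same occurrence in
   [S]. *)
have := sw; rewrite -(time_gt1 (cover _) (time _)) ?mem_part // -e ew.
rewrite (time_gt1 (cover _) (time _)) ?mem_part // => sv.
by rewrite /proc1 (negbTE sw) (negbTE sv) -e ew.
Qed.

Lemma proc1_time_fn : time_fn C T.
Proof.
split.
- move=> v _; rewrite /proc1; case: ifP => [|/negbT sv].
    by rewrite /gamma; lia.
  (* The 0-based position is less than [size S], which is [n - m], so two more is at most
     [n - m + 1]. *)
  have [lt _ _] := occ_posP (occ_range sv).
  rewrite /= /gamma (size_flatten_cover all_chains_cover) size_all_chains.
  by rewrite cardsT card_ord; case: adm => <- _; lia.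
- by move=> v; rewrite is_source_comb /proc1 => ->.
- move=> u v _ _; rewrite !is_source_comb /proc1 => su sv nuv.
  rewrite (negbTE su) (negbTE sv); apply: contra_neq nuv => -[].
  have hu := occ_range su; have hv := occ_range sv.
  case/(occ_pos_inj hu hv) => e ee.
  apply: (time_inj (cover (part u)) (time (part u))).
  + by rewrite !inE eqxx.
  + by rewrite !inE e eqxx.
  + by rewrite {2}e; lia.
- move=> u v uv; have e := chain_edge_part uv; apply: proc1_ltn => //.
  by case: (time (part u)) => _ _ _; apply; rewrite -chain_edge_comb.
Qed.

(** By [Tmax_time] both sides compare [v] with the chain successor of [u], a non-source of the same
    part, and Procedure 1 preserves such comparisons. Hence [T] and [Ti] allow the same edges inside
    a part. *)
Lemma Tmax_comb u v : part u = part v ->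
  (T v <= Tmax C T u) = (Ti (part u) v <= Tmax (cs (part u)) (Ti (part u)) u).
Proof.
move=> e; rewrite (Tmax_time all_chains_cover proc1_time_fn) ?inE //.
rewrite (Tmax_time (cover _) (time _)) ?inE ?e //.
apply: eq_forallb => w; rewrite chain_edge_comb e.
have [uw|//] := boolP (chain_edge _ u w).
rewrite -e -chain_edge_comb in uw.
by rewrite proc1_ltE ?(chain_edge_part uw) //
  (chain_edge_target all_chains_cover uw).
Qed.

Lemma comb_in_GCT (Ep : 'I_l -> {set 'I_n * 'I_n}) (E : {set 'I_n * 'I_n}) :
  (forall i, in_GCT (cs i) (Ti i) (Ep i)) ->
  (forall u v, (u, v) \in E -> T v <= Tmax C T u) ->
  in_GCT C T (comb Ep E).
Proof.
move=> GEp leE; split => u v.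
- by rewrite !(mem_cover all_chains_cover) !inE.
- rewrite chain_edge_comb => uv; rewrite inE; apply/orP; left.
  by apply/bigcupP; exists (part u) => //; case: (GEp (part u)) => _ + _; apply.
- rewrite inE => /orP [/bigcupP [i _ uvE]|/leE]; last by rewrite -leqNgt.
  case: (GEp i) => mE _ nch; have := mE _ _ uvE.
  rewrite !(mem_cover (cover i)) !inE => /andP [/eqP pu /eqP pv].
  rewrite chain_edge_comb -!leqNgt Tmax_comb ?pu ?pv // => nuv.
  by rewrite leqNgt; apply: nch.
Qed.

(** Edges of the maximal graphs stay within their parts and those of [E] cross parts, so the union
    is disjoint. It serves both for the size of the extremal set and for bounding an arbitrary
    competitor. *)
Lemma card_comb_Gmax (E : {set 'I_n * 'I_n}) : inter_edges part E ->
  #|comb (fun i => Gmax (cs i) (Ti i)) E|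
    = #|E| + \sum_(i < l) edge_bound (n_ part i) (m_ cs i).
Proof.
move=> interE; pose G i := Gmax (cs i) (Ti i).
have Gpart i u v : (u, v) \in G i -> part u = i /\ part v = i.
  rewrite inE !(mem_cover (cover i)) !inE => /and3P [/eqP pu /eqP pv _].
  by split.
have -> : \sum_(i < l) edge_bound (n_ part i) (m_ cs i) = \sum_(i < l) #|G i|.
  apply: eq_bigr => i _; have := card_Gmax (cover i) (time i).
  rewrite -(edge_boundE (size_chains_le (cover i))) => /eqP.
  by rewrite eqn_add2r => /eqP ->.
have -> : \sum_(i < l) #|G i| = #|\bigcup_(i < l) G i|.
  rewrite -sum1_card partition_disjoint_bigcup; last first.
    move=> i j nij; rewrite -setI_eq0; apply/eqP/setP => -[u v].
    rewrite in_setI in_set0; apply/negP => /andP [/Gpart [pi _] /Gpart [pj _]].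
    by rewrite -pi -pj eqxx in nij.
  by apply: eq_bigr => i _; rewrite sum1_card.
have dis : (\bigcup_(i < l) G i) :&: E = set0.
  apply/setP => -[u v]; rewrite in_setI in_set0; apply/negP.
  case/andP => /bigcupP [i _ /Gpart [pu pv]] /interE.
  by rewrite pu pv eqxx.
by rewrite addnC -cardsUI dis cards0 addn0.
Qed.

End Combined.

Theorem theorem7 (R : realType) (n l : nat) (part : 'I_n -> 'I_l)
    (cs : 'I_l -> seq (seq 'I_n)) (Ti : 'I_l -> 'I_n -> nat)
    (Gi : 'I_l -> {set 'I_n * 'I_n}) (S : seq 'I_l) (Es : {set 'I_n * 'I_n}) :
  (forall i, chain_cover [set v | part v == i] (cs i)) ->
  (forall i, time_fn (cs i) (Ti i)) ->
  (forall i, in_GCT (cs i) (Ti i) (Gi i)) ->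
  admissible part cs S ->
  inter_edges part Es ->
  let C := all_chains cs in
  let T := proc1 part cs Ti S in
  let VC := [set v | is_source C v] in
  let Gu_SSC (E : {set 'I_n * 'I_n}) :=
    forall Ep : 'I_l -> {set 'I_n * 'I_n},
      (forall i, in_GCT (cs i) (Ti i) (Ep i)) -> SSC R (comb Ep E) VC in
  let Emax := [set e : 'I_n * 'I_n |
                 (part e.1 != part e.2) && (T e.2 <= Tmax C T e.1)] in
  (forall u v, part u != part v -> Tmax C T u < T v -> (u, v) \notin Es) ->
  [/\ Gu_SSC Es,
      inter_edges part Emax /\ Gu_SSC Emax,
      forall E' : {set 'I_n * 'I_n}, inter_edges part E' -> Gu_SSC E' ->
        #|E'| <= #|Emax|
    & (#|Emax| + \sum_(i < l) edge_bound (n_ part i) (m_ cs i)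
         = edge_bound n (\sum_(i < l) m_ cs i))%N].
Proof.
move=> cover time _ adm interEs C T VC Gu_SSC Emax Es_T.
have coverC : chain_cover setT C := all_chains_cover cover.
have timeT : time_fn C T := proc1_time_fn cover time adm.
have ssc_T (E : {set 'I_n * 'I_n}) :
    (forall u v, (u, v) \in E -> T v <= Tmax C T u) -> Gu_SSC E.
  move=> ET Ep GEp; apply: (SSC_of_GCT coverC timeT).
  exact: comb_in_GCT.
have interEmax : inter_edges part Emax.
  by move=> u v; rewrite inE /= => /andP [].
(* Within a part this is [Tmax_comb]; between parts there are no chain edges, so only the time
   condition defining [Emax] is left. *)
have GmaxE : Gmax C T = comb (fun i => Gmax (cs i) (Ti i)) Emax.
  apply/setP => -[u v]; rewrite inE !(mem_cover coverC) !inE /=.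
  have [e|ne] /= := eqVneq (part u) (part v).
    rewrite orbF (chain_edge_comb cover) (Tmax_comb cover time adm) //.
    apply/idP/bigcupP => [uv|[i _]].
      by exists (part u); rewrite // inE !(mem_cover (cover _)) !inE e eqxx -e.
    by rewrite inE !(mem_cover (cover _)) !inE /= => /and3P [/eqP -> _].
  have -> : chain_edge C u v = false.
    by apply: contraNF ne => /(chain_edge_part cover) ->.
  rewrite /= orb_idl // => /bigcupP [i _].
  rewrite inE !(mem_cover (cover _)) !inE /= => /and3P [/eqP pu /eqP pv].
  by rewrite pu pv eqxx in ne.
have le_mn : \sum_(i < l) m_ cs i <= n.
  rewrite -size_all_chains -[X in _ <= X]card_ord -cardsT.
  exact: size_chains_le coverC.
have sizeC : size C = \sum_(i < l) m_ cs i := size_all_chains.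
have cardE : #|Emax| + \sum_(i < l) edge_bound (n_ part i) (m_ cs i)
         = edge_bound n (\sum_(i < l) m_ cs i).
  rewrite -(card_comb_Gmax cover time interEmax) -GmaxE.
  (* Adding the binomial coefficient turns both sides into [n ^ 2]. *)
  apply/eqP; rewrite -(eqn_add2r 'C(n - \sum_(i < l) m_ cs i, 2)).
  rewrite edge_boundE // -{1}sizeC.
  by have := card_Gmax coverC timeT; rewrite cardsT card_ord => ->.
split=> //.
- apply: ssc_T => u v uvE; rewrite leqNgt; apply/negP => lt.
  by have := Es_T u v (interEs _ _ uvE) lt; rewrite uvE.
- by split=> //; apply: ssc_T => u v; rewrite inE /= => /andP [].
- move=> E' interE' sscE'.
  (* Choosing the maximal graph on every part leaves the least room for [E']: the bound of
     [SSC_card] is then attained by [Emax]. *)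
  have := SSC_card (sscE' _ (fun i => Gmax_in_GCT (cover i))).
  rewrite (card_comb_Gmax cover time interE') (card_sources coverC) sizeC.
  by rewrite -(edge_boundE le_mn) -cardE leq_add2r leq_add2r.
Qed.
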